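(* Let $L>0$, $\mu<0$, let $f:\mathbb{R}^d\to\mathbb{R}$ belong to $\mathcal{F}_{\mu,L}$ with $f_*:=\inf_x f(x)>-\infty$, let $N\ge1$ be an integer, and let $x_{i+1}=x_i-\gamma\nabla f(x_i)$, $i=0,\dots,N-1$, be $N$ iterations of gradient descent started from $x_0\in\mathbb{R}^d$ with constant stepsize $\gamma$ satisfying $\gamma L\in(0,2)$. Then $$\frac{1}{2L}\min_{0\le i\le N}\big\{\|\nabla f(x_i)\|^2\big\}\le\frac{f(x_0)-f_*}{1+\gamma L\,\min\Big\{P_N(\gamma L,\gamma\mu),\ \frac{-1+(1-\gamma L)^{-2N}}{\gamma L}\Big\}},$$ where, for $l\in(0,2)$ and $u<0$, $$P_N(l,u):=p(l,u)\bigg[N-\frac{-lu}{l-u}\sum_{k=1}^N\Big[\frac{-1+(1-u)^{-2k}}{u}-\frac{-1+(1-l)^{-2k}}{l}\Big]_+\bigg]$$ and $$p(l,u):=2-\frac{-lu}{1-u-|1-l|}=\begin{cases}2-\dfrac{-lu}{l-u}, & l\in(0,1],\\[2mm] \dfrac{(2-l)(2-u)}{2-l-u}, & l\in[1,2).\end{cases}$$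
   Context: For $L\in(0,\infty)$ and $\mu\in(-\infty,L)$, $\mathcal{F}_{\mu,L}$ is the class of functions $f:\mathbb{R}^d\to\mathbb{R}$ such that both $\frac{L}{2}\|\cdot\|^2-f$ and $f-\frac{\mu}{2}\|\cdot\|^2$ are convex, where $\|\cdot\|$ is the Euclidean norm (such functions are differentiable). $[x]_+:=\max\{x,0\}$. When $l=1$ (i.e. $\gamma L=1$), $(1-l)^{-2k}$ is read as $+\infty$: each bracket $[\cdot]_+$ in the sum is then $0$, and the minimum equals $P_N(\gamma L,\gamma\mu)$. *)

(* Defs.v *)
From HB Require Import structures.
From mathcomp Require Import all_boot all_order all_algebra.
From mathcomp Require Import all_classical all_reals all_analysis.
From mathcomp Require Import ring.
Set Implicit Arguments.
Unset Strict Implicit.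
Unset Printing Implicit Defensive.
Import Order.TTheory GRing.Theory Num.Theory.
Import numFieldNormedType.Exports.
Local Open Scope classical_set_scope.
Local Open Scope ring_scope.

(* The library's norm `|v| on 'rV[R]_d is the sup norm. *)
Definition enorm (R : realType) (d : nat) (v : 'rV[R]_d) : R :=
  Num.sqrt (\sum_(j < d) v 0 j ^+ 2).

Definition gradient (R : realType) (d : nat) (f : 'rV[R]_d -> R)
    (x : 'rV[R]_d) : 'rV[R]_d :=
  \row_(j < d) 'D_(delta_mx 0 j) f x.

(* The class F_{mu,L}; differentiability is a consequence of the two
   convexity conditions. *)
Definition curvature_class (R : realType) (d : nat) (mu L : R)
    (f : 'rV[R]_d -> R) : Prop :=
  convex_function [set: 'rV[R]_d] (fun x => L / 2 * enorm x ^+ 2 - f x) /\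
  convex_function [set: 'rV[R]_d] (fun x => f x - mu / 2 * enorm x ^+ 2).

Definition rate_p (R : realType) (l u : R) : R :=
  2 - (- (l * u)) / (1 - u - `|1 - l|).

Lemma rate_p_short (R : realType) (l u : R) :
  l \in `]0, 1] -> rate_p l u = 2 - (- (l * u)) / (l - u).
Proof.
rewrite in_itv /= => /andP[_ l1]; rewrite /rate_p ger0_norm ?subr_ge0//.
by congr (_ - _ / _); ring.
Qed.

Lemma rate_p_long (R : realType) (l u : R) : u < 0 ->
  l \in `[1, 2[ -> rate_p l u = (2 - l) * (2 - u) / (2 - l - u).
Proof.
move=> u0; rewrite in_itv /= => /andP[l1 l2].
rewrite /rate_p ler0_norm ?subr_le0//.
have h : 2 - l - u != 0 by rewrite gt_eqF// subr_gt0 (lt_trans u0)// subr_gt0.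
have -> : 1 - u - - (1 - l) = 2 - l - u by ring.
by apply: (mulIf h); rewrite mulrBl !divfK//; ring.
Qed.

Definition geom_term (R : realType) (k : nat) (x : R) : R :=
  (- 1 + (1 - x) ^- (2 * k)) / x.

(* In rate_bracket and rate_min, the case l = 1 realizes the convention
   (1 - l)^(-2k) = +oo; the library's value for it would be 0. *)
Definition rate_bracket (R : realType) (l u : R) (k : nat) : R :=
  if l == 1 then 0 else Num.max (geom_term k u - geom_term k l) 0.

Definition rate_P (R : realType) (N : nat) (l u : R) : R :=
  rate_p l u *
  (N%:R - (- (l * u)) / (l - u) * \sum_(1 <= k < N.+1) rate_bracket l u k).

Definition rate_min (R : realType) (N : nat) (l u : R) : R :=
  if l == 1 then rate_P N l u else Num.min (rate_P N l u) (geom_term N l).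

(* Main.v *)
Require Import Defs.
From HB Require Import structures.
From mathcomp Require Import all_boot all_order all_algebra.
From mathcomp Require Import all_classical all_reals all_analysis.
From mathcomp Require Import ring lra.
Set Implicit Arguments.
Unset Strict Implicit.
Unset Printing Implicit Defensive.
Import Order.TTheory GRing.Theory Num.Theory.
Import numFieldNormedType.Exports.
Local Open Scope classical_set_scope.
Local Open Scope ring_scope.

(** Write G_i = gamma g_i for the scaled gradients along the iteration, l = gamma L,
u = gamma mu. The proof uses the smoothness and curvature of f only through the
interpolation inequality between two points of the class
([curvature_interpolation]), and that only for iterates that are one or two
steps apart. For consecutive iterates it bounds the decrease
2 gamma (f(x_i) - f(x_{i+1})) from below by a quadratic form in G_i, G_{i+1};
added to itself with the two points exchanged, it says that a certain inner
product, the slack, is nonnegative. These facts are collected in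
[descent_trace], and the rest is an argument about a sequence of vectors.

For l <= 1 the quadratic form is at least p(l, u) min |G_i|^2, all brackets in
P_N vanish, and summing the steps is enough ([descent_short_step]).

For l > 1 put a = 1 - u > 1 and b = l - 1 in ]0, 1[. Splitting the quadratic
form of one step into squares and slack gives
2 gamma (f(x_i) - f(x_{i+1}))
  >= ((a - b - ab) |G_i|^2 + |G_{i+1}|^2) / (a - b) + 2b / (a^2 - b^2) slack,
and adding these does not suffice, since the coefficient of |G_0|^2 may be
negative. Instead the weights are moved forward along the trajectory: the identity
[certificate_identity] exchanges squares of three consecutive gradients for
nonnegative terms, and adding suitable multiples of it gives
[telescoped_bound]. The multiples obey a linear recurrence with characteristic
roots a^-2 and b^-2, which is where (1-u)^(-2k) and (1-l)^(-2k) come from: they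
are proportional to gap k, the difference of the two geometric terms in the
bracket of P_N. This is legitimate as long as gap k >= 0. Now gap is concave in
k with gap 0 = 0, so it changes sign at most once ([gap_lt0]). If gap N >= 0,
eliminating G_{N-1} leaves the second term of the minimum
([descent_gap_ge0]); if gap N < 0, the telescoped bound is used up to the sign
change, where its coefficients add up to the closed form of P, and single steps,
each worth p(l, u), are added from there on ([descent_gap_lt0]).

In both cases 2 gamma (f(x_0) - f(x_N)) is bounded below; a last gradient step of
length 1/L from x_N shows f(x_N) - f_* >= |g_N|^2 / (2L) ([gradient_gap]), which
accounts for the summand 1 in the denominator of the rate. *)

(** * First-order bounds for functions of curvature in [mu, L] *)

Definition dot (R : realType) (d : nat) (v w : 'rV[R]_d) : R :=
  \sum_(j < d) v 0 j * w 0 j.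

Lemma dotC (R : realType) (d : nat) (v w : 'rV[R]_d) : dot v w = dot w v.
Proof. by apply: eq_bigr => j _; rewrite mulrC. Qed.

Lemma dotDl (R : realType) (d : nat) (a b v : 'rV[R]_d) :
  dot (a + b) v = dot a v + dot b v.
Proof. by rewrite -big_split; apply: eq_bigr => j _; rewrite mxE mulrDl. Qed.

Lemma dotZl (R : realType) (d : nat) (k : R) (a v : 'rV[R]_d) :
  dot (k *: a) v = k * dot a v.
Proof. by rewrite mulr_sumr; apply: eq_bigr => j _; rewrite mxE mulrA. Qed.

Lemma dotNl (R : realType) (d : nat) (a v : 'rV[R]_d) : dot (- a) v = - dot a v.
Proof. by rewrite -scaleN1r dotZl mulN1r. Qed.

Lemma dotDr (R : realType) (d : nat) (a b v : 'rV[R]_d) :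
  dot v (a + b) = dot v a + dot v b.
Proof. by rewrite !(dotC v) dotDl. Qed.

Lemma dotZr (R : realType) (d : nat) (k : R) (a v : 'rV[R]_d) :
  dot v (k *: a) = k * dot v a.
Proof. by rewrite !(dotC v) dotZl. Qed.

Lemma dotNr (R : realType) (d : nat) (a v : 'rV[R]_d) : dot v (- a) = - dot v a.
Proof. by rewrite !(dotC v) dotNl. Qed.

Definition dotE := (dotDl, dotDr, dotZl, dotZr, dotNl, dotNr).

Lemma dot_ge0 (R : realType) (d : nat) (v : 'rV[R]_d) : 0 <= dot v v.
Proof. by apply: sumr_ge0 => j _; rewrite -expr2 sqr_ge0. Qed.

Lemma enorm_sqr (R : realType) (d : nat) (v : 'rV[R]_d) :
  enorm v ^+ 2 = dot v v.
Proof.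
rewrite /enorm sqr_sqrtr; first by apply: eq_bigr => j _; rewrite expr2.
by apply: sumr_ge0 => j _; rewrite sqr_ge0.
Qed.

Lemma convex_weights (R : realType) (d : nat) (g : 'rV[R]_d -> R) (v w : 'rV[R]_d)
    (t : R) : convex_function [set: 'rV[R]_d] g -> 0 <= t <= 1 ->
  g (t *: v + (1 - t) *: w) <= t * g v + (1 - t) * g w.
Proof.
move=> cg /andP[t0 t1].
have t01 : Itv.spec (@Itv.num_sem R) (Itv.Real `[0%Z, 1%Z]) t.
  by rewrite /= /Itv.num_sem /= in_itv /= t0 t1 ger0_real.
have := cg (Itv.mk t01) v w; rewrite !inE => /(_ Logic.I Logic.I).
by rewrite convRE.
Qed.

Lemma convex_slope_nd (R : realType) (phi : R -> R)
    (phi0 : phi 0 = 0)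
    (cphi : forall a b t, 0 <= t <= 1 ->
       phi (t * a + (1 - t) * b) <= t * phi a + (1 - t) * phi b) (s t : R) :
  s != 0 -> t != 0 -> s < t -> phi s / s <= phi t / t.
Proof.
move=> s0 t0 st.
have [tp|tn] := ltP 0 t.
  have [sp|sn] := ltP 0 s.
    have H : 0 <= s / t <= 1.
      by rewrite divr_ge0 ?(ltW sp) ?(ltW tp)//= ler_pdivrMr// mul1r ltW.
    have := cphi t 0 _ H; rewrite mulr0 addr0 phi0 mulr0 addr0 divfK//.
    by move=> h; rewrite ler_pdivrMr//; apply: le_trans h _;
      rewrite -mulrA mulrC [t^-1 * _]mulrC.
  have sn' : s < 0 by rewrite lt_neqAle s0 sn.
  have ts : 0 < t - s by rewrite subr_gt0.
  have H : 0 <= t / (t - s) <= 1.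
    rewrite divr_ge0 ?(ltW ts) ?(ltW tp)//= ler_pdivrMr// mul1r; lra.
  have := cphi s t _ H.
  have -> : t / (t - s) * s + (1 - t / (t - s)) * t = 0 by field; rewrite gt_eqF.
  rewrite phi0 => h.
  have h2 : 0 <= t * phi s - s * phi t.
    have -> : t * phi s - s * phi t =
       (t - s) * (t / (t - s) * phi s + (1 - t / (t - s)) * phi t).
      by field; rewrite gt_eqF.
    by apply: mulr_ge0 => //; exact: ltW.
  rewrite ler_pdivlMr// mulrAC ler_ndivrMr//; lra.
have tn' : t < 0 by rewrite lt_neqAle t0 tn.
have sn : s < 0 by exact: lt_trans tn'.
have H : 0 <= t / s <= 1.
  by rewrite mulr_le0 ?invr_le0 ?(ltW tn') ?(ltW sn)//= ler_ndivrMr// mul1r ltW.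
have := cphi s 0 _ H; rewrite mulr0 addr0 phi0 mulr0 addr0 divfK//.
by move=> h; rewrite ler_ndivlMr//; apply: le_trans h _;
  rewrite -mulrA mulrC [s^-1 * _]mulrC.
Qed.

(** Lets an error term that is linear in the vanishing parameter be dropped,
whatever the sign of its constant. *)
Lemma ler_addgt0_scaled (R : realType) (K a b : R) :
  (forall e, 0 < e -> a <= b + K * e) -> a <= b.
Proof.
move=> H; apply/ler_addgt0Pr => e e0.
have p0 : 0 < 1 + `|K| by rewrite ltr_pwDl.
apply: le_trans (H (e / (1 + `|K|)) (divr_gt0 e0 p0)) _.
rewrite lerD2l mulrCA ler_piMr ?(ltW e0)// ler_pdivrMr// mul1r.
by rewrite (le_trans (ler_norm _))// lerDr.
Qed.

(** The value D is the derivative of k at 0. It is found as a supremum of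
corrected slopes over negative arguments, because those slopes are monotone; the
bounds on the other side come from comparing with a vanishing argument of
opposite sign. *)
Lemma quadratic_slope (R : realType) (A B : R) (k : R -> R) :
  (forall s t, s != 0 -> t != 0 -> s < t ->
     A * (t - s) <= k t / t - k s / s <= B * (t - s)) -> k 0 = 0 ->
  exists D, forall t, A * t ^+ 2 <= k t - D * t <= B * t ^+ 2.
Proof.
move=> H k0.
pose S := [set k s / s - A * s | s in [set s : R | s < 0]].
have ub t : 0 < t -> ubound S (k t / t - A * t).
  move=> t0 _ /= [s s0 <-].
  have := H s t; rewrite (lt_eqF s0) (gt_eqF t0) (lt_trans s0 t0).
  move=> /(_ isT isT isT).
  case/andP; lra.
have S0 : S !=set0 by exists (k (-1) / (-1) - A * (-1)); exists (-1) => //=; lra.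
have hS : has_sup S by split => //; exists (k 1 / 1 - A * 1); apply: ub.
exists (sup S) => t.
have Dup s : 0 < s -> sup S <= k s / s - A * s.
  by move=> s0; apply: ge_sup => //; apply: ub.
have Dlo s : s < 0 -> k s / s - A * s <= sup S.
  by move=> s0; apply: ub_le_sup; [case: hS|exists s].
have [t0|t0|->] := ltgtP t 0; last first.
- by rewrite k0 expr0n /= !mulr0 subr0 lexx.
- suff [h1 h2] : A * t <= k t / t - sup S /\ k t / t - sup S <= B * t.
    have -> : k t - sup S * t = t * (k t / t - sup S) by field; rewrite gt_eqF.
    have e C : C * t ^+ 2 = t * (C * t) by ring.
    by rewrite !e !ler_pM2l// h1 h2.
  split; first by have := Dup _ t0; lra.
  apply: (@ler_addgt0_scaled _ (B - A)) => c c0.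
  have := H (- c) t; rewrite oppr_eq0 (gt_eqF c0) (gt_eqF t0).
  have -> : - c < t by lra.
  move=> /(_ isT isT isT) /andP[_ h2].
  have := Dlo (- c); rewrite oppr_lt0 => /(_ c0) h3; lra.
- suff [h1 h2] : B * t <= k t / t - sup S /\ k t / t - sup S <= A * t.
    have -> : k t - sup S * t = t * (k t / t - sup S) by field; rewrite lt_eqF.
    have e C : C * t ^+ 2 = t * (C * t) by ring.
    by rewrite !e !ler_nM2l// h1 h2.
  split; last by have := Dlo _ t0; lra.
  apply: (@ler_addgt0_scaled _ (B - A)) => c c0.
  have := H t c; rewrite (lt_eqF t0) (gt_eqF c0) (lt_trans t0 c0).
  move=> /(_ isT isT isT) /andP[_ h2].
  have := Dup _ c0; lra.
Qed.

Lemma derive_quadratic_slope (R : realType) (d : nat) (f : 'rV[R]_d -> R)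
    (x v : 'rV[R]_d) (A B D : R) :
  (forall t, A * t ^+ 2 <= f (x + t *: v) - f x - D * t <= B * t ^+ 2) ->
  'D_v f x = D.
Proof.
move=> H; rewrite /derive; apply/cvg_lim => //.
apply/cvgrPdist_le => e e0.
pose C := 1 + `|A| + `|B|.
have C0 : 0 < C by rewrite /C -addrA ltr_pwDl// addr_ge0.
have eC : 0 < e / C by apply: divr_gt0.
near=> h.
have h0 : h != 0 by near: h; exact: nbhs_dnbhs_neq.
have hs : `|h| <= e / C.
  near: h; apply: nbhs_dnbhs; apply: (@nbhs0_le R R^o) => //.
rewrite /= /GRing.scale /= [h *: v + x]addrC.
have -> : D - h^-1 * (f (x + h *: v) - f x) =
   - (f (x + h *: v) - f x - D * h) / h by field.
rewrite normrM normrN normfV ler_pdivrMr ?normr_gt0//.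
have /andP[h1 h2] := H h.
have h3 : `|f (x + h *: v) - f x - D * h| <= C * `|h| ^+ 2.
  rewrite ler_norml -normrX ger0_norm ?sqr_ge0//; apply/andP; split.
    apply: le_trans h1; rewrite -mulNr ler_wpM2r ?sqr_ge0//.
    have := ler_norm (- A); rewrite normrN /C; have := normr_ge0 B; lra.
  apply: (le_trans h2); rewrite ler_wpM2r ?sqr_ge0//.
  have := ler_norm B; rewrite /C; have := normr_ge0 A; lra.
apply: (le_trans h3); rewrite expr2 mulrA ler_wpM2r//.
by rewrite mulrC -ler_pdivlMr.
Unshelve. all: by end_near.
Qed.

Lemma convex_function_slope_nd (R : realType) (d : nat) (g : 'rV[R]_d -> R)
    (x v : 'rV[R]_d) (s t : R) : convex_function [set: 'rV[R]_d] g ->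
  s != 0 -> t != 0 -> s < t ->
  (g (x + s *: v) - g x) / s <= (g (x + t *: v) - g x) / t.
Proof.
move=> cg s0 t0 st.
apply: (@convex_slope_nd _ (fun r => g (x + r *: v) - g x)) => //.
  by rewrite scale0r addr0 subrr.
move=> a b r r01.
have := convex_weights (x + a *: v) (x + b *: v) cg r01.
have -> : r *: (x + a *: v) + (1 - r) *: (x + b *: v) =
    x + (r * a + (1 - r) * b) *: v.
  by apply/rowP => j; rewrite !mxE; ring.
lra.
Qed.

(** Along a line, subtracting a quadratic from f makes its slopes monotone in
one direction or the other, so the slopes of f itself are squeezed between two
linear functions. *)
Lemma curvature_directional (R : realType) (d : nat) (mu L : R)
    (f : 'rV[R]_d -> R) (x v : 'rV[R]_d) (t : R) : curvature_class mu L f ->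
  mu / 2 * dot v v * t ^+ 2 <= f (x + t *: v) - f x - 'D_v f x * t
    <= L / 2 * dot v v * t ^+ 2.
Proof.
move=> [cL cmu].
have [D HD] : exists D, forall t, mu / 2 * dot v v * t ^+ 2 <=
    (f (x + t *: v) - f x) - D * t <= L / 2 * dot v v * t ^+ 2.
  apply: quadratic_slope; last by rewrite scale0r addr0 subrr.
  move=> a b a0 b0 ab.
  have := convex_function_slope_nd x v cL a0 b0 ab.
  have := convex_function_slope_nd x v cmu a0 b0 ab.
  have E (c h : R) : h != 0 ->
     c * enorm (x + h *: v) ^+ 2 =
       c * enorm x ^+ 2 + h * (2 * c * dot x v + c * dot v v * h).
    by move=> h0; rewrite !enorm_sqr !dotE (dotC v x); ring.
  rewrite !E//.
  have E1 (h p q r s : R) : h != 0 -> (p - (q + h * r) - (s - q)) / h = (p - s) / h - r.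
    by move=> h0; field.
  have E2 (h p q r s : R) : h != 0 -> (q + h * r - p - (q - s)) / h = r - (p - s) / h.
    by move=> h0; field.
  rewrite !E1// !E2//; lra.
by rewrite (derive_quadratic_slope HD).
Qed.

(** The directional derivative is subadditive, because f minus mu/2 times the
squared norm is convex at the midpoint of x + 2e v and x + 2e w, the error being
of second order in e. Applied to - v and - w, subadditivity reverses. *)
Lemma derive_additive (R : realType) (d : nat) (mu L : R)
    (f : 'rV[R]_d -> R) (x : 'rV[R]_d) : curvature_class mu L f ->
  (forall c v, 'D_(c *: v) f x = c * 'D_v f x) /\
  (forall v w, 'D_(v + w) f x = 'D_v f x + 'D_w f x).
Proof.
move=> fC.
have dZ c v : 'D_(c *: v) f x = c * 'D_v f x.
  apply: (@derive_quadratic_slope _ _ _ _ _ (mu / 2 * dot v v * c ^+ 2)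
            (L / 2 * dot v v * c ^+ 2)) => t.
  have := curvature_directional x v (t * c) fC.
  have E p : p * (t * c) ^+ 2 = p * c ^+ 2 * t ^+ 2 by ring.
  have E' p : p * (t * c) = c * p * t by ring.
  by rewrite scalerA !E E'.
split=> //.
have dD v w : 'D_(v + w) f x <= 'D_v f x + 'D_w f x.
  pose K := L * (dot v v + dot w w) - mu * (dot v v + dot w w).
  apply: (@ler_addgt0_scaled _ K) => e e0.
  case: (fC) => _ cmu.
  have h01 : 0 <= (2^-1 : R) <= 1 by lra.
  have := convex_weights (x + (2 * e) *: v) (x + (2 * e) *: w) cmu h01.
  have -> : 2^-1 *: (x + (2 * e) *: v) + (1 - 2^-1) *: (x + (2 * e) *: w)
      = x + e *: (v + w).
    by apply/rowP => j; rewrite !mxE; field.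
  have /andP[h1 _] := curvature_directional x (v + w) e fC.
  have /andP[_ h2] := curvature_directional x v (2 * e) fC.
  have /andP[_ h3] := curvature_directional x w (2 * e) fC.
  move: h1 h2 h3; rewrite !enorm_sqr !dotE (dotC v x) (dotC w x) (dotC w v).
  move=> h1 h2 h3 h4.
  rewrite -(ler_pM2l e0) /K.
  lra.
move=> v w; apply/eqP; rewrite eq_le dD /=.
have dN y : 'D_(- y) f x = - 'D_y f x by rewrite -scaleN1r dZ mulN1r.
have := dD (- v) (- w); rewrite -opprD !dN; lra.
Qed.

(** Linearity in the direction makes the vector of partial derivatives represent
every directional derivative. *)
Lemma gradient_derive (R : realType) (d : nat) (mu L : R)
    (f : 'rV[R]_d -> R) (x v : 'rV[R]_d) : curvature_class mu L f ->
  'D_v f x = dot (gradient f x) v.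
Proof.
move=> fC; have [dZ dD] := derive_additive x fC.
have d0 : 'D_(0 : 'rV[R]_d) f x = 0 by rewrite -(scale0r (0 : 'rV[R]_d)) dZ mul0r.
rewrite {1}(row_sum_delta v) (big_morph (fun w => 'D_w f x) dD d0).
by apply: eq_bigr => j _; rewrite dZ !mxE mulrC.
Qed.

Lemma curvature_bounds (R : realType) (d : nat) (mu L : R)
    (f : 'rV[R]_d -> R) (x v : 'rV[R]_d) : curvature_class mu L f ->
  mu / 2 * dot v v <= f (x + v) - f x - dot (gradient f x) v <= L / 2 * dot v v.
Proof.
move=> fC; have := curvature_directional x v 1 fC.
by rewrite (gradient_derive _ _ fC) scale1r expr1n !mulr1.
Qed.

(** Evaluate the upper quadratic bound at x and the lower one at y in the same
point z, chosen to minimise the gap between the two parabolas. *)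
Lemma curvature_interpolation (R : realType) (d : nat) (mu L : R)
    (f : 'rV[R]_d -> R) (x y : 'rV[R]_d) (g := gradient f) : mu < 0 -> 0 < L ->
  curvature_class mu L f ->
  (dot (g x - g y) (g x - g y) + mu * L * dot (x - y) (x - y)
     - 2 * mu * dot (g x - g y) (x - y)) / (2 * (L - mu))
  <= f x - f y - dot (g y) (x - y).
Proof.
move=> mu0 L0 fC.
have p0 : 0 < L - mu by lra.
pose w := x - y; pose h := g x - g y; pose r := (L - mu)^-1.
(* z minimises the upper parabola at x minus the lower parabola at y. *)
pose z := x - r *: (h - mu *: w).
have /andP[_ h1] := curvature_bounds x (z - x) fC.
have /andP[h2 _] := curvature_bounds y (z - y) fC.
move: h1 h2; rewrite ![_ + (z - _)]addrC !subrK -/g.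
have -> : z - x = - r *: (h - mu *: w) by rewrite /z addrC addKr scaleNr.
have -> : z - y = w - r *: (h - mu *: w) by rewrite /z /w addrAC.
have -> : g x = g y + h by rewrite /h addrC subrK.
rewrite -/w [g y + h - g y]addrAC subrr add0r.
clearbody z w h.
rewrite !dotE (dotC w h) => h1 h2.
pose K := dot h h - 2 * mu * dot h w + mu ^+ 2 * dot w w.
have -> : (dot h h + mu * L * dot w w - 2 * mu * dot h w) / (2 * (L - mu)) =
    mu / 2 * (dot w w - 2 * r * (dot h w - mu * dot w w) + r ^+ 2 * K)
    - L / 2 * (r ^+ 2 * K) + r * (dot h h - mu * dot h w).
  by rewrite /K /r; field; rewrite gt_eqF.
by rewrite /K; lra.
Qed.

(** * The sequences of weights *)

Lemma geom_term0 (R : realType) (x : R) : geom_term 0 x = 0.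
Proof. by rewrite /geom_term muln0 expr0 invr1 addNr mul0r. Qed.

Lemma geom_termS (R : realType) (k : nat) (x : R) : x != 0 -> x != 1 ->
  geom_term k.+1 x = (geom_term k x + 2 - x) / (1 - x) ^+ 2.
Proof.
move=> x0 x1; have h : 1 - x != 0 by rewrite subr_eq0 eq_sym.
rewrite /geom_term mulnS exprD.
have hk : (1 - x) ^+ (2 * k) != 0 by rewrite expf_neq0.
by move: ((1 - x) ^+ (2 * k)) hk => p p0; field; rewrite p0 x0 h.
Qed.

Lemma geom_term_ge0 (R : realType) (k : nat) (x : R) :
  x != 0 -> x != 1 -> x < 2 -> 0 <= geom_term k x.
Proof.
move=> x0 x1 x2; elim: k => [|k ih]; first by rewrite geom_term0.
rewrite geom_termS// divr_ge0 ?sqr_ge0//; lra.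
Qed.

(** Consecutive increments of the geometric term have ratio (1 - x)^-2, so the
term is concave in k for x < 0 and convex for 0 < x < 2. *)
Lemma geom_term_increment (R : realType) (k : nat) (x : R) : x != 0 -> x != 1 ->
  (1 - x) ^+ 2 * (geom_term k.+2 x - geom_term k.+1 x) =
  geom_term k.+1 x - geom_term k x.
Proof.
move=> x0 x1; have h : 1 - x != 0 by rewrite subr_eq0 eq_sym.
rewrite (geom_termS k.+1 x0 x1).
have : (1 - x) ^+ 2 * geom_term k.+1 x = geom_term k x + 2 - x.
  by rewrite geom_termS//; field.
by move=> e; rewrite mulrBr e; field.
Qed.

Lemma geom_term_nd (R : realType) (k : nat) (x : R) :
  x != 0 -> x != 1 -> x < 2 -> geom_term k x <= geom_term k.+1 x.
Proof.
move=> x0 x1 x2; have h : 0 < (1 - x) ^+ 2.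
  by rewrite exprn_even_gt0//= subr_eq0 eq_sym.
elim: k => [|k ih]; first by rewrite geom_term0 geom_term_ge0.
by rewrite -subr_ge0 -(pmulr_rge0 _ h) geom_term_increment// subr_ge0.
Qed.

(** With a = 1 - u and b = l - 1 this is the content of the bracket in P_N. The
variables a and b turn the contraction factors 1 - u and |1 - l| of gradient
descent on the two extreme quadratics into positive numbers. *)
Definition gap (R : realType) (a b : R) (k : nat) : R :=
  geom_term k (1 - a) - geom_term k (1 + b).

Lemma geom_termS_u (R : realType) (a : R) (k : nat) : 1 < a ->
  geom_term k.+1 (1 - a) = (geom_term k (1 - a) + 1 + a) / a ^+ 2.
Proof.
move=> a1; rewrite geom_termS; [field; lra| |]; apply/eqP; lra.
Qed.

Lemma geom_termS_l (R : realType) (b : R) (k : nat) : 0 < b < 1 ->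
  geom_term k.+1 (1 + b) = (geom_term k (1 + b) + 1 - b) / b ^+ 2.
Proof.
move=> /andP[b0 b1]; rewrite geom_termS; [field; lra| |]; apply/eqP; lra.
Qed.

Lemma geom_term_u_ge0 (R : realType) (a : R) (k : nat) : 1 < a ->
  0 <= geom_term k (1 - a).
Proof. by move=> a1; apply: geom_term_ge0; [apply/eqP|apply/eqP|]; lra. Qed.

Lemma geom_term_l_ge0 (R : realType) (b : R) (k : nat) : 0 < b < 1 ->
  0 <= geom_term k (1 + b).
Proof. by move=> /andP[b0 b1]; apply: geom_term_ge0; [apply/eqP|apply/eqP|]; lra. Qed.

Lemma gap0 (R : realType) (a b : R) : gap a b 0 = 0.
Proof. by rewrite /gap !geom_term0 subrr. Qed.

Lemma gap_concave (R : realType) (a b : R) (k : nat) : 1 < a -> 0 < b < 1 ->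
  gap a b k.+2 - gap a b k.+1 <= gap a b k.+1 - gap a b k.
Proof.
move=> a1 /andP[b0 b1].
have ha0 : 1 - a != 0 by apply/eqP; lra.
have ha1 : 1 - a != 1 by apply/eqP; lra.
have hb0 : 1 + b != 0 by apply/eqP; lra.
have hb1 : 1 + b != 1 by apply/eqP; lra.
have a2 : 1 - a < 2 by lra.
have b2 : 1 + b < 2 by lra.
have := geom_term_nd k.+1 ha0 ha1 a2; rewrite -subr_ge0 => pa.
have := geom_term_nd k.+1 hb0 hb1 b2; rewrite -subr_ge0 => pb.
have := geom_term_increment k hb0 hb1; have := geom_term_increment k ha0 ha1.
rewrite (_ : 1 - (1 - a) = a); last by ring.
rewrite (_ : 1 - (1 + b) = - b) ?sqrrN; last by ring.
have ca : 0 <= (a ^+ 2 - 1) * (geom_term k.+2 (1 - a) - geom_term k.+1 (1 - a)).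
  by rewrite mulr_ge0// subr_ge0 exprn_ege1// ltW.
have cb : 0 <= (1 - b ^+ 2) * (geom_term k.+2 (1 + b) - geom_term k.+1 (1 + b)).
  by rewrite mulr_ge0// subr_ge0 exprn_ile1// ltW.
rewrite /gap; lra.
Qed.

(** A concave sequence that starts at 0 keeps decreasing once it is negative;
hence gap changes sign at most once. *)
Lemma gap_lt0 (R : realType) (a b : R) (k : nat) : 1 < a -> 0 < b < 1 ->
  gap a b k < 0 -> gap a b k.+1 < gap a b k.
Proof.
move=> a1 b01; elim: k => [|k ih]; first by rewrite gap0 ltxx.
move=> gk; have := gap_concave k a1 b01.
have [g0|g0] := ltP (gap a b k) 0; first by have := ih g0; lra.
lra.
Qed.

(** Coefficient of the slack of the first pair in [certificate_identity]. *)
Definition cert_prev (R : realType) (a b : R) : R :=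
  2 * a * b * (a ^+ 2 + b ^+ 2 + a - b) / (a + b) ^+ 2.

(** Coefficient of the slack of the second pair in [certificate_identity]. *)
Definition cert_next (R : realType) (a b : R) : R :=
  2 * (a * b * (a - b) - a ^+ 2 - b ^+ 2) / (a + b) ^+ 2.

(** The multiple of [certificate_identity] spent on reaching index k in
[telescoped_bound]. *)
Definition gap_weight (R : realType) (a b : R) (k : nat) : R :=
  gap a b k / (a ^+ 2 - b ^+ 2).

(** The multiple of the slack that is left over in [telescoped_bound] after the
certificate has consumed its share. *)
Definition slack_weight (R : realType) (a b : R) (k : nat) : R :=
  2 * b / (a ^+ 2 - b ^+ 2) - gap_weight a b k * cert_next a b.

(** The weight left over at step k pays for what the certificate consumes at
step k+1. The difference is affine in the geometric terms x and y of index k,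
with positive coefficients, so that the worst case is k = 0, where both vanish. *)
Lemma slack_weight_ge (R : realType) (a b : R) (k : nat) : 1 < a -> 0 < b < 1 ->
  gap_weight a b k.+1 * cert_prev a b <= slack_weight a b k.
Proof.
move=> a1 b01; have /andP[b0 b1] := b01.
rewrite /slack_weight /gap_weight.
rewrite /cert_prev /cert_next /gap geom_termS_u// geom_termS_l//.
have := geom_term_u_ge0 k a1; have := geom_term_l_ge0 k b01.
move: (geom_term k (1 - a)) (geom_term k (1 + b)) => x y y0 x0.
have s0 : 0 < a + b by lra.
have D0 : 0 < a - b by lra.
rewrite -subr_ge0.
have -> : a ^+ 2 - b ^+ 2 = (a + b) * (a - b) by ring.
set lhs := (X in 0 <= X).
have -> : lhs = 2 / (a * (a + b) ^+ 3) * ((a ^+ 2 - b) * (1 - b)) * x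
  + 2 / (b * (a + b) ^+ 3) * (a ^+ 2 + b ^+ 2 + a + a * b ^+ 2) * y
  + 2 * (1 - b) * (a - b + a ^+ 2) / (a * b * (a + b) ^+ 2).
  by rewrite /lhs; field; do !(apply/andP; split); apply/eqP; lra.
have a0 : 0 < a by lra.
have b1' : 0 < 1 - b by lra.
have hab : 0 < a ^+ 2 - b by have : 1 < a ^+ 2 by [rewrite exprn_egt1]; lra.
have P1 : 0 < (a + b) ^+ 3 by rewrite exprn_gt0.
have P2 : 0 < (a + b) ^+ 2 by rewrite exprn_gt0.
have P3 : 0 <= a ^+ 2 by rewrite sqr_ge0.
have P4 : 0 <= b ^+ 2 by rewrite sqr_ge0.
have P5 : 0 <= a * b ^+ 2 by rewrite mulr_ge0// ltW.
apply: addr_ge0; [apply: addr_ge0|].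
- apply: mulr_ge0 => //; apply: mulr_ge0; last by rewrite mulr_ge0 // ltW.
  by rewrite divr_ge0// mulr_ge0// ltW.
- apply: mulr_ge0 => //; apply: mulr_ge0; last by lra.
  by rewrite divr_ge0// mulr_ge0// ltW.
- rewrite divr_ge0//; last by rewrite !mulr_ge0// ltW.
  by rewrite !mulr_ge0//; lra.
Qed.

Lemma cert_next_le_prev (R : realType) (a b : R) : 1 < a -> 0 < b < 1 ->
  cert_next a b <= cert_prev a b.
Proof.
move=> a1 /andP[b0 b1].
rewrite /cert_prev /cert_next ler_pM2r; last by rewrite invr_gt0 exprn_gt0//; lra.
have P3 : 0 <= a ^+ 2 by rewrite sqr_ge0.
have P4 : 0 <= b ^+ 2 by rewrite sqr_ge0.
have P5 : 0 <= a * b * (a ^+ 2 + b ^+ 2) by rewrite !mulr_ge0 ?addr_ge0//; lra.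
lra.
Qed.

Lemma gap_weight_ge0 (R : realType) (a b : R) (k : nat) : 1 < a -> 0 < b < 1 ->
  (0 <= gap_weight a b k) = (0 <= gap a b k).
Proof.
move=> a1 /andP[b0 b1]; rewrite /gap_weight pmulr_lge0// invr_gt0 subr_sqr.
by rewrite mulr_gt0//; lra.
Qed.

Lemma gap_ge0_pred (R : realType) (a b : R) (k : nat) : 1 < a -> 0 < b < 1 ->
  0 <= gap a b k.+1 -> 0 <= gap a b k.
Proof.
move=> a1 b01 g1; rewrite leNgt; apply/negP => g0.
have := gap_lt0 a1 b01 g0; lra.
Qed.

(** When [cert_next] is positive, it is dominated by [cert_prev], and the
previous instance of [slack_weight_ge] bounds the subtracted term. *)
Lemma slack_weight_ge0 (R : realType) (a b : R) (k : nat) : 1 < a -> 0 < b < 1 ->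
  0 <= gap a b k -> 0 <= slack_weight a b k.
Proof.
move=> a1 b01 gk; have /andP[b0 b1] := b01.
have nu00 : 0 <= 2 * b / (a ^+ 2 - b ^+ 2).
  by rewrite divr_ge0 ?subr_sqr ?mulr_ge0//; lra.
rewrite /slack_weight subr_ge0.
have dk : 0 <= gap_weight a b k by rewrite gap_weight_ge0.
have [y0|y0] := lerP (cert_next a b) 0.
  by apply: le_trans nu00; rewrite mulr_ge0_le0.
case: k gk dk => [|k] gk dk; first by rewrite /gap_weight gap0 !mul0r.
have := slack_weight_ge k a1 b01; rewrite /slack_weight => H.
apply: le_trans (ler_wpM2l dk (cert_next_le_prev a1 b01)) _.
apply: le_trans H _; rewrite gerBl mulr_ge0// ?(ltW y0)//.
by rewrite gap_weight_ge0//; apply: gap_ge0_pred gk.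
Qed.

(** Everything on the right vanishes for gradient descent on a quadratic whose
Hessian has only the eigenvalues mu and L: its gradients are multiplied by a on
one eigenspace and by - b on the other at each step, and these are the roots of
t^2 - (a - b) t - ab. The three inner products are slacks, of the pair (A, C) two
steps apart and of the consecutive pairs (A, B) and (B, C). *)
Lemma certificate_identity (R : realType) (d : nat) (a b : R)
    (A B C : 'rV[R]_d) : a + b != 0 ->
  (a ^+ 2 + b ^+ 2) * dot B B - a ^+ 2 * b ^+ 2 * dot A A - dot C C =
  (a - b) ^+ 2 / (a + b) ^+ 2 *
    dot (C - (a - b) *: B - (a * b) *: A) (C - (a - b) *: B - (a * b) *: A)
  + 2 * a * b * (a - b) / (a + b) ^+ 2 *
    dot (a *: A + (a - 1) *: B - C) (b *: A + (1 + b) *: B + C)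
  - cert_prev a b *
    dot (a *: A - B) (b *: A + B)
  - cert_next a b *
    dot (a *: B - C) (b *: B + C).
Proof.
move=> s0; rewrite /cert_prev /cert_next !dotE (dotC B A) (dotC C A) (dotC C B).
by field.
Qed.

(** * Steps longer than 1/L *)

(** For A, B consecutive scaled gradients, the interpolation inequality added to
its mirror image states that this is nonnegative. *)
Definition slack (R : realType) (d : nat) (a b : R) (A B : 'rV[R]_d) : R :=
  dot (a *: A - B) (b *: A + B).

(** What the descent argument retains of gradient descent: G are the scaled
gradients, F the function values scaled by 2 gamma. The three clauses are the
interpolation inequality for a step, its symmetrised form, and the symmetrised
form for two steps. *)
Definition descent_trace (R : realType) (d : nat) (a b : R) (N : nat)
    (G : nat -> 'rV[R]_d) (F : nat -> R) : Prop :=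
  [/\ forall i, (i < N)%N ->
        (dot (G i.+1) (G i.+1) + (a + b - a * b) * dot (G i) (G i)
           + 2 * b * dot (G i) (G i.+1)) / (a + b) <= F i - F i.+1,
      forall i, (i < N)%N -> 0 <= slack a b (G i) (G i.+1) &
      forall i, (i.+1 < N)%N ->
        0 <= dot (a *: G i + (a - 1) *: G i.+1 - G i.+2)
                 (b *: G i + (1 + b) *: G i.+1 + G i.+2)].

Lemma step_identity (R : realType) (d : nat) (a b : R) (A B : 'rV[R]_d) :
  a - b != 0 -> a + b != 0 ->
  (dot B B + (a + b - a * b) * dot A A + 2 * b * dot A B) / (a + b) =
  ((a - b - a * b) * dot A A + dot B B) / (a - b)
    + 2 * b / (a ^+ 2 - b ^+ 2) * slack a b A B.
Proof.
move=> D0 s0; rewrite /slack !dotE (dotC B A) subr_sqr; field.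
by rewrite D0 s0.
Qed.

Lemma gap_weight1 (R : realType) (a b : R) : 1 < a -> 0 < b < 1 ->
  a ^+ 2 * b ^+ 2 * gap_weight a b 1 = - (a - b - a * b) / (a - b).
Proof.
move=> a1 b01; have /andP[b0 b1] := b01.
rewrite /gap_weight /gap geom_termS_u// geom_termS_l// !geom_term0 subr_sqr; field.
by do !(apply/andP; split); apply/eqP; lra.
Qed.

(** The inhomogeneous recurrence with characteristic roots a^-2 and b^-2; its
constant is p(l, u). *)
Lemma gap_weightSS (R : realType) (a b : R) k : 1 < a -> 0 < b < 1 ->
  a ^+ 2 * b ^+ 2 * gap_weight a b k.+2 = (a ^+ 2 + b ^+ 2) * gap_weight a b k.+1
    - gap_weight a b k - (1 - b) * (1 + a) / (a - b).
Proof.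
move=> a1 b01; have /andP[b0 b1] := b01.
rewrite /gap_weight /gap !geom_termS_u// !geom_termS_l// subr_sqr; field.
by do !(apply/andP; split); apply/eqP; lra.
Qed.

(** Induction on k. The step adds the decrease of the new iteration and
gap_weight k.+1 times [certificate_identity]; the recurrence [gap_weightSS] is
what makes the coefficient of |G_{k+1}|^2 match, and [slack_weight_ge] keeps the
multiplier of the older slack nonnegative. *)
Lemma telescoped_bound (R : realType) (d : nat) (a b : R) (N : nat)
    (G : nat -> 'rV[R]_d) (F : nat -> R) (k : nat) : 1 < a -> 0 < b < 1 ->
  descent_trace a b N G F -> (k < N)%N -> 0 <= gap a b k ->
  ((a - b)^-1 + gap_weight a b k) * dot (G k.+1) (G k.+1)
    - a ^+ 2 * b ^+ 2 * gap_weight a b k.+1 * dot (G k) (G k)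
    + slack_weight a b k * slack a b (G k) (G k.+1) <= F 0%N - F k.+1.
Proof.
move=> a1 b01 [hT hS hS2]; have /andP[b0 b1] := b01.
have D0 : a - b != 0 by apply/eqP; lra.
have s0 : a + b != 0 by apply/eqP; lra.
elim: k => [|k ih] kN gk.
  have := hT _ kN; rewrite step_identity// => h; apply: le_trans h.
  rewrite /slack_weight gap_weight1//.
  rewrite [gap_weight _ _ _]/gap_weight gap0 mul0r mul0r subr0 addr0.
  by rewrite subr_sqr le_eqVlt; apply/orP; left; apply/eqP; field; rewrite D0 s0.
have gk' := gap_ge0_pred a1 b01 gk.
have H := ih (ltnW kN) gk'.
have := hT _ kN; rewrite step_identity// => T.
have S1 := hS _ (ltnW kN); have S2 := hS2 _ kN.
have dk : 0 <= gap_weight a b k.+1 by rewrite gap_weight_ge0.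
have nk := slack_weight_ge k a1 b01.
have cert := certificate_identity (G k) (G k.+1) (G k.+2) s0.
have r0 := dot_ge0 (G k.+2 - (a - b) *: G k.+1 - (a * b) *: G k).
rewrite gap_weightSS// {1}/slack_weight.
rewrite -/(slack a b (G k) (G k.+1)) -/(slack a b (G k.+1) (G k.+2)) in cert.
move: r0 S2 cert; set rr := dot (G k.+2 - _ - _) _; set s2 := dot (_ + _ - _) _.
move=> r0 S2 cert.
have K1 : 0 <= (a - b) ^+ 2 / (a + b) ^+ 2 * rr.
  by rewrite mulr_ge0// divr_ge0 ?sqr_ge0.
have K2 : 0 <= 2 * a * b * (a - b) / (a + b) ^+ 2 * s2.
  by rewrite mulr_ge0// divr_ge0 ?sqr_ge0// !mulr_ge0//; lra.
have K3 : 0 <= gap_weight a b k.+1 *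
    ((a ^+ 2 + b ^+ 2) * dot (G k.+1) (G k.+1) - a ^+ 2 * b ^+ 2 * dot (G k) (G k)
     - dot (G k.+2) (G k.+2) + cert_prev a b * slack a b (G k) (G k.+1)
     + cert_next a b * slack a b (G k.+1) (G k.+2)).
  by rewrite mulr_ge0//; lra.
have K4 : 0 <= (slack_weight a b k - gap_weight a b k.+1 * cert_prev a b) *
    slack a b (G k) (G k.+1).
  by rewrite mulr_ge0// subr_ge0.
have e : (a - b - a * b) / (a - b) = (1 - b) * (1 + a) / (a - b) - (a - b)^-1.
  by field.
have e2 X Y : ((a - b - a * b) * X + Y) / (a - b) =
   (a - b - a * b) / (a - b) * X + Y * (a - b)^-1 by field.
rewrite e2 e in T.
move: T H; set n0 := 2 * b / _; set rho := _ / (a - b); set Di := (a - b)^-1 => T H.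
lra.
Qed.

(** Only part of the slack is kept, in the amount that turns the negative multiple
of |G_N|^2 in [telescoped_bound] into a nonnegative multiple of
|G_{N+1} + b G_N|^2, at the cost of a multiple of |G_{N+1}|^2. Equality
G_{N+1} = - b G_N is the behaviour on the quadratic of curvature L, where the
term with (1-l)^(-2N) is attained. *)
Lemma descent_gap_ge0 (R : realType) (d : nat) (a b : R) (N : nat)
    (G : nat -> 'rV[R]_d) (F : nat -> R) : 1 < a -> 0 < b < 1 ->
  descent_trace a b N.+1 G F -> 0 <= gap a b N.+1 ->
  geom_term N.+1 (1 + b) * dot (G N.+1) (G N.+1) <= F 0%N - F N.+1.
Proof.
move=> a1 b01 tr gN; have /andP[b0 b1] := b01.
have H := telescoped_bound a1 b01 tr (ltnSn N) (gap_ge0_pred a1 b01 gN).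
case: tr => _ hS _; have S0 := hS _ (ltnSn N).
have dN : 0 <= gap_weight a b N.+1 by rewrite gap_weight_ge0.
(* The share of the slack that completes the square q0. *)
pose nu' := 2 * b * a ^+ 2 / (a + b) * gap_weight a b N.+1.
have nn : nu' <= slack_weight a b N.
  apply: le_trans (slack_weight_ge N a1 b01); rewrite /nu' [leRHS]mulrC ler_wpM2r//.
  rewrite -subr_ge0 (_ : _ - _ = 2 * a * b * ((a - b) * (1 - b)) / (a + b) ^+ 2).
    by rewrite divr_ge0 ?sqr_ge0// !mulr_ge0//; lra.
  by rewrite /cert_prev; field; apply/eqP; lra.
have H2 := ler_wpM2r S0 nn.
have e : a ^+ 2 * gap_weight a b N.+1 =
    gap_weight a b N + (a - b)^-1 - geom_term N.+1 (1 + b).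
  rewrite /gap_weight /gap geom_termS_u// geom_termS_l// subr_sqr; field.
  by do !(apply/andP; split); apply/eqP; lra.
have q0 : 0 <= a ^+ 2 * (a - b) / (a + b) * gap_weight a b N.+1 *
    dot (G N.+1 + b *: G N) (G N.+1 + b *: G N).
  rewrite mulr_ge0 ?dot_ge0// mulr_ge0// divr_ge0 ?mulr_ge0 ?sqr_ge0//; lra.
have eq : a ^+ 2 * (a - b) / (a + b) * gap_weight a b N.+1 *
    dot (G N.+1 + b *: G N) (G N.+1 + b *: G N) =
   a ^+ 2 * gap_weight a b N.+1 * dot (G N.+1) (G N.+1)
    - a ^+ 2 * b ^+ 2 * gap_weight a b N.+1 * dot (G N) (G N)
   + nu' * slack a b (G N) (G N.+1).
  rewrite /nu' /slack !dotE (dotC (G N.+1)); field; apply/eqP; lra.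
rewrite eq e in q0; lra.
Qed.

(** The value of P_k before the brackets start to vanish, in terms of a = 1 - u
and b = l - 1. *)
Definition rate_closed_form (R : realType) (a b : R) (k : nat) : R :=
  ((1 - b ^+ 2) * geom_term k (1 - a) + (a ^+ 2 - 1) * geom_term k (1 + b)) /
  (a ^+ 2 - b ^+ 2).

Lemma rate_PS (R : realType) (l u : R) (k : nat) :
  rate_P k.+1 l u = rate_P k l u +
    rate_p l u * (1 - (- (l * u)) / (l - u) * rate_bracket l u k.+1).
Proof.
by rewrite /rate_P [in LHS]big_nat_recr//= -natr1; ring.
Qed.

Lemma rate_P0 (R : realType) (l u : R) : rate_P 0 l u = 0.
Proof. by rewrite /rate_P big_geq// !mulr0 subr0 mulr0. Qed.

Lemma rate_p_ab (R : realType) (a b : R) : 1 < a -> 0 < b < 1 ->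
  rate_p (1 + b) (1 - a) = (1 - b) * (1 + a) / (a - b).
Proof.
move=> a1 /andP[b0 b1]; rewrite rate_p_long ?in_itv/=; [|lra|lra].
by congr (_ * _ / _); ring.
Qed.

Lemma rate_bracket_gap_ge0 (R : realType) (a b : R) k : 0 < b -> 0 <= gap a b k ->
  rate_bracket (1 + b) (1 - a) k = gap a b k.
Proof.
move=> b0 gk; rewrite /rate_bracket ifF; last by apply/eqP; lra.
exact/max_idPl.
Qed.

Lemma rate_bracket_gap_le0 (R : realType) (a b : R) k : 0 < b -> gap a b k <= 0 ->
  rate_bracket (1 + b) (1 - a) k = 0.
Proof.
move=> b0 gk; rewrite /rate_bracket; case: ifP => // _.
exact/max_idPr.
Qed.

Lemma rate_P_closed_form (R : realType) (a b : R) k : 1 < a -> 0 < b < 1 ->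
  0 <= gap a b k -> rate_P k (1 + b) (1 - a) = rate_closed_form a b k.
Proof.
move=> a1 b01; have /andP[b0 b1] := b01.
elim: k => [|k ih] gk.
  by rewrite rate_P0 /rate_closed_form !geom_term0 !mulr0 addr0 mul0r.
rewrite rate_PS rate_bracket_gap_ge0// ih; last exact: gap_ge0_pred gk.
rewrite rate_p_ab// /rate_closed_form /gap geom_termS_u// geom_termS_l// subr_sqr; field.
by do !(apply/andP; split); apply/eqP; lra.
Qed.

Lemma rate_P_ge0 (R : realType) (a b : R) k : 1 < a -> 0 < b < 1 ->
  0 <= rate_P k (1 + b) (1 - a).
Proof.
move=> a1 b01; have /andP[b0 b1] := b01.
elim: k => [|k ih]; first by rewrite rate_P0.
have [gk|gk] := lerP 0 (gap a b k.+1).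
  rewrite rate_P_closed_form// /rate_closed_form divr_ge0//; last first.
    by rewrite subr_sqr mulr_ge0//; lra.
  apply: addr_ge0.
    by rewrite mulr_ge0 ?geom_term_u_ge0// subr_ge0 exprn_ile1// ltW.
  by rewrite mulr_ge0 ?geom_term_l_ge0// subr_ge0 exprn_ege1// ltW.
rewrite rate_PS rate_bracket_gap_le0 ?(ltW gk)// mulr0 subr0 mulr1 addr_ge0//.
by rewrite rate_p_ab// divr_ge0 ?mulr_ge0//; lra.
Qed.

(** Induction on N. If gap N is still nonnegative, the telescoped bound has
nonnegative coefficients at both squares, which add up to P_{N+1}; otherwise one
more plain step adds p(l, u). The term with |G_N|^2 is kept so that the next step
can use it against its possibly negative first coefficient. *)
Lemma descent_gap_lt0 (R : realType) (d : nat) (a b m : R) (N : nat)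
    (G : nat -> 'rV[R]_d) (F : nat -> R) : 1 < a -> 0 < b < 1 ->
  descent_trace a b N G F -> (forall i, (i <= N)%N -> m <= dot (G i) (G i)) ->
  gap a b N < 0 ->
  (rate_P N (1 + b) (1 - a) - (a - b)^-1) * m + (a - b)^-1 * dot (G N) (G N)
    <= F 0%N - F N.
Proof.
move=> a1 b01; have /andP[b0 b1] := b01.
have D0 : 0 < a - b by lra.
have s0 : 0 < a + b by lra.
have Di : 0 < (a - b)^-1 by rewrite invr_gt0.
elim: N => [|N ih]; first by rewrite gap0 ltxx.
move=> tr mG gN.
rewrite rate_PS rate_bracket_gap_le0 ?(ltW gN)// mulr0 subr0 mulr1 rate_p_ab//.
have [gk|gk] := lerP 0 (gap a b N).
  have H := telescoped_bound a1 b01 tr (ltnSn N) gk.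
  case: (tr) => _ hS _.
  have S0 := mulr_ge0 (slack_weight_ge0 a1 b01 gk) (hS _ (ltnSn N)).
  rewrite rate_P_closed_form//.
  have e : rate_closed_form a b N + (1 - b) * (1 + a) / (a - b) - (a - b)^-1 =
      gap_weight a b N - a ^+ 2 * b ^+ 2 * gap_weight a b N.+1.
    rewrite /rate_closed_form /gap_weight /gap geom_termS_u// geom_termS_l// subr_sqr; field.
    by do !(apply/andP; split); apply/eqP; lra.
  have dN : 0 <= gap_weight a b N by rewrite gap_weight_ge0.
  have dN1 : 0 <= - (a ^+ 2 * b ^+ 2 * gap_weight a b N.+1).
    rewrite -mulrN; apply: mulr_ge0; first by rewrite mulr_ge0 ?sqr_ge0.
    by rewrite oppr_ge0 ltW// ltNge gap_weight_ge0// -ltNge.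
  have := ler_wpM2l dN (mG _ (leqnn _)).
  have := ler_wpM2l dN1 (mG _ (leqnSn _)).
  rewrite e; lra.
case: (tr) => hT hS hS2.
have trN : descent_trace a b N G F.
  by split=> i iN; [apply: hT|apply: hS|apply: hS2]; exact: ltnW.
have H := ih trN (fun i iN => mG i (leqW iN)) gk.
have := hT _ (ltnSn N); rewrite step_identity ?gt_eqF//.
have S0 := hS _ (ltnSn N).
have S1 : 0 <= 2 * b / (a ^+ 2 - b ^+ 2) * slack a b (G N) (G N.+1).
  by rewrite mulr_ge0// divr_ge0 ?subr_sqr ?mulr_ge0//; lra.
have e : ((a - b - a * b) * dot (G N) (G N) + dot (G N.+1) (G N.+1)) / (a - b) =
   ((1 - b) * (1 + a) / (a - b) - (a - b)^-1) * dot (G N) (G N)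
   + (a - b)^-1 * dot (G N.+1) (G N.+1) by field; rewrite gt_eqF.
rewrite e => T.
have r0 : 0 <= (1 - b) * (1 + a) / (a - b) by rewrite divr_ge0 ?mulr_ge0//; lra.
have := ler_wpM2l r0 (mG _ (leqnSn _)).
lra.
Qed.

(** * The inequalities satisfied by gradient descent *)

Lemma scaled_interpolation (R : realType) (d : nat) (L mu gamma : R)
    (f : 'rV[R]_d -> R) (x y : 'rV[R]_d) (l := gamma * L) (u := gamma * mu)
    (G := fun z => gamma *: gradient f z) :
  0 < gamma -> mu < 0 -> 0 < L -> curvature_class mu L f ->
  2 * dot (G y) (x - y) + (dot (G x - G y) (G x - G y)
    + l * u * dot (x - y) (x - y) - 2 * u * dot (G x - G y) (x - y)) / (l - u)
  <= 2 * gamma * f x - 2 * gamma * f y.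
Proof.
move=> g0 mu0 L0 fC.
have := curvature_interpolation x y mu0 L0 fC.
have g20 : 0 < 2 * gamma by lra.
have h : 0 < L - mu by lra.
rewrite -(ler_pM2l g20) /G -scalerBr.
move: (gradient f x - gradient f y) (x - y) => p q.
rewrite !dotE /l /u => H.
have e : (gamma * (gamma * dot p p) + gamma * L * (gamma * mu) * dot q q -
     2 * (gamma * mu) * (gamma * dot p q)) / (gamma * L - gamma * mu) =
   2 * gamma * ((dot p p + mu * L * dot q q - 2 * mu * dot p q) / (2 * (L - mu))).
  by field; rewrite -mulrBr mulf_neq0 ?gt_eqF.
rewrite e; lra.
Qed.

(** Sum of the interpolation inequality and its mirror image, where the
function values cancel. *)
Lemma gradient_slack (R : realType) (d : nat) (L mu gamma : R)
    (f : 'rV[R]_d -> R) (x y : 'rV[R]_d) (l := gamma * L) (u := gamma * mu)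
    (H := gamma *: gradient f x - gamma *: gradient f y) :
  0 < gamma -> mu < 0 -> 0 < L -> curvature_class mu L f ->
  0 <= dot (H - u *: (x - y)) (l *: (x - y) - H).
Proof.
move=> g0 mu0 L0 fC.
have lu : 0 < l - u by rewrite -mulrBr mulr_gt0//; lra.
have := scaled_interpolation x y g0 mu0 L0 fC.
have := scaled_interpolation y x g0 mu0 L0 fC.
rewrite -/l -/u.
have -> : gamma *: gradient f x = gamma *: gradient f y + H.
  by rewrite /H addrC subrK.
have e1 (p q : 'rV[R]_d) : p - (p + q) = - q by rewrite opprD addrA subrr add0r.
have e2 (p q : 'rV[R]_d) : p + q - p = q by rewrite addrC addKr.
rewrite e1 e2 -[y - x]opprB.
move: H (x - y) => H q.
rewrite !dotE; clearbody l u.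
have e X : X / (l - u) = (l - u)^-1 * X by rewrite mulrC.
rewrite !e; set r := (l - u)^-1 => h1 h2.
have {h1 h2} h : 0 <= (l - u) * (dot H q -
    (dot H H + l * u * dot q q - 2 * u * dot H q) / (l - u)).
  by rewrite mulr_ge0 ?(ltW lu)// e -/r; lra.
move: h; rewrite mulrBr [_ * (_ / _)]mulrC divfK ?gt_eqF// (dotC q H); lra.
Qed.

Lemma gd_descent_trace (R : realType) (d : nat) (L mu gamma : R)
    (f : 'rV[R]_d -> R) (N : nat) (x : nat -> 'rV[R]_d) :
  0 < gamma -> mu < 0 -> 0 < L -> curvature_class mu L f ->
  (forall i : nat, (i < N)%N -> x i.+1 = x i - gamma *: gradient f (x i)) ->
  descent_trace (1 - gamma * mu) (gamma * L - 1) N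
    (fun i => gamma *: gradient f (x i)) (fun i => 2 * gamma * f (x i)).
Proof.
move=> g0 mu0 L0 fC gd.
have lu : 0 < gamma * L - gamma * mu by rewrite -mulrBr mulr_gt0//; lra.
have d1 i : (i < N)%N -> x i - x i.+1 = gamma *: gradient f (x i).
  by move=> /gd ->; rewrite opprB addrC subrK.
have d2 i : (i.+1 < N)%N -> x i - x i.+2 =
    gamma *: gradient f (x i) + gamma *: gradient f (x i.+1).
  by move=> iN; rewrite -(d1 _ (ltnW iN)) -(d1 _ iN) addrA subrK.
split=> i iN.
- have := scaled_interpolation (x i) (x i.+1) g0 mu0 L0 fC.
  rewrite d1//; apply: le_trans.
  move: (gamma *: gradient f (x i)) (gamma *: gradient f (x i.+1)) => A B.
  rewrite le_eqVlt; apply/orP; left; apply/eqP.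
  rewrite !dotE (dotC B A); field.
  by rewrite gt_eqF//; apply/eqP; lra.
- have := gradient_slack (x i) (x i.+1) g0 mu0 L0 fC.
  rewrite d1// /slack.
  move: (gamma *: gradient f (x i)) (gamma *: gradient f (x i.+1)) => A B.
  congr (0 <= dot _ _); apply/rowP => j; rewrite !mxE; ring.
- have := gradient_slack (x i) (x i.+2) g0 mu0 L0 fC.
  rewrite d2//.
  move: (gamma *: gradient f (x i)) (gamma *: gradient f (x i.+1)) => A B.
  move: (gamma *: gradient f (x i.+2)) => C.
  congr (0 <= dot _ _); apply/rowP => j; rewrite !mxE; ring.
Qed.

(** One gradient step of length 1/L from x cannot go below the infimum. *)
Lemma gradient_gap (R : realType) (d : nat) (mu L : R)
    (f : 'rV[R]_d -> R) (x : 'rV[R]_d) : 0 < L -> curvature_class mu L f ->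
  has_lbound (range f) ->
  1 / (2 * L) * dot (gradient f x) (gradient f x) <= f x - inf (range f).
Proof.
move=> L0 fC lb.
have /andP[_ h] := curvature_bounds x (- (L^-1 *: gradient f x)) fC.
have : inf (range f) <= f (x - L^-1 *: gradient f x).
  by apply: ge_inf => //; exists (x - L^-1 *: gradient f x).
move: h; rewrite !dotE.
move: (dot _ _) => q h1 h2.
have -> : 1 / (2 * L) * q = L^-1 * q - L / 2 * (L^-1 * (L^-1 * q)).
  by field; rewrite gt_eqF.
lra.
Qed.

(** * Steps of length at most 1/L *)

(** For l < 1 all brackets vanish, since 1 - u >= 1 >= 1 - l makes the recurrence
of the geometric term grow faster at l than at u. *)
Lemma rate_P_short (R : realType) (l u : R) (N : nat) : 0 < l <= 1 -> u < 0 ->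
  rate_P N l u = rate_p l u * N%:R.
Proof.
move=> /andP[l0 l1] u0; rewrite /rate_P big1 ?mulr0 ?subr0// => k _.
rewrite /rate_bracket; case: eqP => // /eqP ln1; apply/max_idPr.
have l1' : l < 1 by rewrite lt_neqAle ln1 l1.
rewrite subr_le0; elim: k => [|k ih]; first by rewrite !geom_term0.
have un0 : u != 0 by rewrite lt_eqF.
have un1 : u != 1 by apply/eqP; lra.
have ln0 : l != 0 by rewrite gt_eqF.
have e0 : 0 <= geom_term k u by rewrite geom_term_ge0//; lra.
rewrite !geom_termS//.
have p1 : 0 < 1 - l by lra.
have q1 : 1 <= 1 - u by lra.
have i1 : (1 - u)^-1 <= (1 - l)^-1 by rewrite lef_pV2 ?posrE//; lra.
have i0 : 0 <= (1 - u)^-1 by rewrite invr_ge0; lra.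
have i2 : (1 - u)^-1 ^+ 2 <= (1 - l)^-1 ^+ 2.
  by rewrite lerXn2r ?nnegrE// (le_trans i0).
have e (c x : R) : x != 1 -> (c + 2 - x) / (1 - x) ^+ 2 =
    (1 - x)^-1 ^+ 2 * c + (1 - x)^-1 + (1 - x)^-1 ^+ 2.
  by move=> x1; field; rewrite subr_eq0 eq_sym.
rewrite !e//; apply: lerD => //; apply: lerD => //.
by apply: ler_pM => //; rewrite sqr_ge0.
Qed.

(** For l <= 1 the cross term in the step is absorbed by (1 - l) |G_i - G_{i+1}|^2,
and the remaining coefficients of the two squares sum up to p(l, u). *)
Lemma descent_short_step (R : realType) (d : nat) (l u m : R) (N : nat)
    (G : nat -> 'rV[R]_d) (F : nat -> R) : 0 < l <= 1 -> u < 0 -> 0 <= m ->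
  descent_trace (1 - u) (l - 1) N G F ->
  (forall i, (i <= N)%N -> m <= dot (G i) (G i)) ->
  rate_p l u * N%:R * m <= F 0%N - F N.
Proof.
move=> l01 u0 m0 [hT _ _] mG; have /andP[l0 l1] := l01.
rewrite rate_p_short ?in_itv ?l0//=.
have lu : 0 < l - u by lra.
elim: N hT mG => [|N ih] hT mG; first by rewrite mulr0 mul0r subrr.
have := ih (fun i iN => hT i (ltnW iN)) (fun i iN => mG i (leqW iN)).
have := hT _ (ltnSn N).
have c0 : 0 <= (l + u * l - 2 * u) / (l - u).
  rewrite divr_ge0 ?(ltW lu)//.
  have : 0 <= - u * (1 - l) by rewrite mulr_ge0; lra.
  lra.
have := ler_wpM2l c0 (mG _ (leqnSn N)).
have c1 : 0 <= l / (l - u) by rewrite divr_ge0 ?ltW.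
have := ler_wpM2l c1 (mG _ (leqnn N.+1)).
have c2 : 0 <= (1 - l) / (l - u) by rewrite divr_ge0 ?(ltW lu)// subr_ge0.
have := mulr_ge0 c2 (dot_ge0 (G N - G N.+1)).
rewrite !dotE (dotC (G N.+1) (G N)) -natr1.
set A := dot (G N) (G N); set B := dot (G N.+1) (G N.+1); set C := dot (G N) (G N.+1).
have -> : (B + (1 - u + (l - 1) - (1 - u) * (l - 1)) * A + 2 * (l - 1) * C) /
     (1 - u + (l - 1)) = (1 - l) / (l - u) * (A - C + - (C - B))
     + l / (l - u) * B + (l + u * l - 2 * u) / (l - u) * A.
  by field; rewrite gt_eqF//; apply/eqP; lra.
have -> : 2 - - (l * u) / (l - u) = l / (l - u) + (l + u * l - 2 * u) / (l - u).
  by field; rewrite gt_eqF.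
lra.
Qed.

(** * The rate *)

Lemma descent_rate (R : realType) (d : nat) (l u m : R) (N : nat)
    (G : nat -> 'rV[R]_d) (F : nat -> R) : 0 < l < 2 -> u < 0 -> 0 <= m ->
  (1 <= N)%N -> descent_trace (1 - u) (l - 1) N G F ->
  (forall i, (i <= N)%N -> m <= dot (G i) (G i)) ->
  0 <= rate_min N l u /\ rate_min N l u * m <= F 0%N - F N.
Proof.
move=> /andP[l0 l2] u0 m0 N1 tr mG.
have g0 : l != 1 -> 0 <= geom_term N l.
  by move=> l1; rewrite geom_term_ge0// gt_eqF.
have [l1|l1] := lerP l 1.
  have l01 : 0 < l <= 1 by rewrite l0 l1.
  have lu : 0 < l - u by lra.
  have P0 : 0 <= rate_P N l u.
    rewrite rate_P_short// mulr_ge0// rate_p_short ?in_itv/= ?l01//.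
    rewrite subr_ge0 ler_pdivrMr//.
    have : 0 <= - u * (2 - l) by rewrite mulr_ge0; lra.
    lra.
  have H := descent_short_step l01 u0 m0 tr mG; rewrite -rate_P_short// in H.
  rewrite /rate_min; case: eqP => // /eqP ln1; split.
    by rewrite le_min P0 g0.
  by apply: le_trans H; rewrite ler_wpM2r// ge_min lexx.
have a1 : 1 < 1 - u by lra.
have b01 : 0 < l - 1 < 1 by lra.
have ln1 : l != 1 by rewrite gt_eqF.
have el : 1 + (l - 1) = l by ring.
have eu : 1 - (1 - u) = u by ring.
have P0 : 0 <= rate_P N l u by have := rate_P_ge0 N a1 b01; rewrite el eu.
rewrite /rate_min (negPf ln1); split; first by rewrite le_min P0 g0.
have [gN|gN] := lerP 0 (gap (1 - u) (l - 1) N).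
  case: N N1 tr mG g0 P0 gN => // N _ tr mG g0 P0 gN.
  have := descent_gap_ge0 a1 b01 tr gN; rewrite el; apply: le_trans.
  apply: (@le_trans _ _ (geom_term N.+1 l * m)).
    by rewrite ler_wpM2r// ge_min lexx orbT.
  by rewrite ler_wpM2l ?g0 ?mG.
have := descent_gap_lt0 a1 b01 tr mG gN; rewrite el eu.
have D0 : 0 < 1 - u - (l - 1) by lra.
have Di : 0 <= (1 - u - (l - 1))^-1 by rewrite invr_ge0 ltW.
have h := ler_wpM2l Di (mG _ (leqnn N)).
apply: le_trans; apply: (@le_trans _ _ (rate_P N l u * m)).
  by rewrite ler_wpM2r// ge_min lexx.
lra.
Qed.

Theorem theorem2p4 (R : realType) (d : nat) (L mu gamma : R)
    (f : 'rV[R]_d -> R) (N : nat) (x : nat -> 'rV[R]_d)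
    (L_gt0 : 0 < L) (mu_lt0 : mu < 0)
    (f_class : curvature_class mu L f)
    (f_lb : has_lbound (range f))
    (N_ge1 : (1 <= N)%N)
    (gd : forall i : nat, (i < N)%N ->
      x i.+1 = x i - gamma *: gradient f (x i))
    (step : 0 < gamma * L < 2) :
  1 / (2 * L) *
    \big[Num.min/enorm (gradient f (x 0%N)) ^+ 2]_(0 <= i < N.+1)
      enorm (gradient f (x i)) ^+ 2
  <= (f (x 0%N) - inf (range f)) /
     (1 + gamma * L * rate_min N (gamma * L) (gamma * mu)).
Proof.
set m := \big[_/_]_(_ <= _ < _) _.
have /andP[l0 _] := step.
have g0 : 0 < gamma by rewrite -(pmulr_lgt0 _ L_gt0).
have m0 : 0 <= m.
  rewrite /m; elim/big_ind: _ => [|p q p0 q0|i _]; rewrite ?sqr_ge0//.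
  by rewrite le_min p0 q0.
have mi i : (i <= N)%N -> m <= dot (gradient f (x i)) (gradient f (x i)).
  move=> iN; rewrite -enorm_sqr /m; apply: ge_bigmin_seq => //.
  by rewrite mem_index_iota ltnS iN.
have u0 : gamma * mu < 0 by rewrite pmulr_rlt0.
have tr := gd_descent_trace g0 mu_lt0 L_gt0 f_class gd.
have gm0 : 0 <= gamma ^+ 2 * m by rewrite mulr_ge0 ?sqr_ge0.
have mG i : (i <= N)%N ->
    gamma ^+ 2 * m <= dot (gamma *: gradient f (x i)) (gamma *: gradient f (x i)).
  by move=> iN; rewrite dotZl dotZr mulrA -expr2 ler_wpM2l ?sqr_ge0 ?mi.
have [r0 H] := descent_rate step u0 gm0 N_ge1 tr mG.
have last := gradient_gap (x N) L_gt0 f_class f_lb.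
have hm : 1 / (2 * L) * m <= f (x N) - inf (range f).
  apply: le_trans last; rewrite ler_wpM2l ?mi//.
  by rewrite divr_ge0 ?mulr_ge0// ltW.
rewrite ler_pdivlMr; last by rewrite ltr_pwDl// mulr_ge0 ?(ltW l0).
move: H r0; set r := rate_min _ _ _ => H r0.
have g20 : 0 < 2 * gamma by lra.
have H2 : gamma / 2 * m * r <= f (x 0%N) - f (x N).
  rewrite -(ler_pM2l g20) mulrBr; apply: le_trans H.
  by rewrite le_eqVlt; apply/orP; left; apply/eqP; field.
have -> : 1 / (2 * L) * m * (1 + gamma * L * r) =
   1 / (2 * L) * m + gamma / 2 * m * r by field; rewrite gt_eqF.
lra.
Qed.
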